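(* Let $\hat M = M(\hat{\bm x})$ be the plug-in maximum likelihood estimator and $L$ the average Kullback-Leibler loss in the multi-relational network model described in the context. Assume that $\bm x^* \in \Theta = \mathcal{E}^N \times \mathcal{R}^K$, where $\mathcal{E}$ and $\mathcal{R}$ are Euclidean balls of radius $U$, and that $|\phi(\bm u) - \phi(\bm v)| \le \alpha \|\bm u - \bm v\|$ for all $\bm u, \bm v \in \mathcal{E}^2 \times \mathcal{R}$. Then for every $t>0$, $\beta>0$ and $0<s<nt$, $$P\big(L(\hat M, M^* ) \geq t\big) \leq \exp\left\{ -\frac{nt-s}{C}\, h\!\left(\frac{1}{2} - \frac{s}{2nt}\right) \right\} \left(1+\frac{2\sqrt{3}\,\alpha U n(1+\beta)}{s}\right)^m + \exp\left\{-n\beta h(\beta)\right\},$$ where $m = Nd_E + Kd_R$, $n = \gamma N^2K$, and $h(u) = \left(1+\frac{1}{u}\right)\log(1+u) - 1$.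
   Context: Notation: $[N]=\{1,\dots,N\}$; $\sigma(x) = e^x/(1+e^x)$; $D(p\|q) = p\log\frac{p}{q} + (1-p)\log\frac{1-p}{1-q}$ is the Kullback-Leibler divergence between Bernoulli$(p)$ and Bernoulli$(q)$; $\|\cdot\|$ is the Euclidean norm. Model: There are $N$ entities and $K$ relations; $\Lambda = [N]\times[N]\times[K]$ is the set of edges. $\mathcal{E}\subset\mathbb{R}^{d_E}$ and $\mathcal{R}\subset\mathbb{R}^{d_R}$ are compact sets, $\Theta = \mathcal{E}^N\times\mathcal{R}^K$, and elements of $\Theta$ are written $\bm x = (\bm\theta_1,\dots,\bm\theta_N,\bm w_1,\dots,\bm w_K)$. For $\lambda=(i,j,k)\in\Lambda$ put $\bm x_\lambda = (\bm\theta_i,\bm\theta_j,\bm w_k)$. Given a score function $\phi:\mathcal{E}^2\times\mathcal{R}\to\mathbb{R}$, let $M_\lambda(\bm x) = \sigma(\phi(\bm x_\lambda))$ and $M(\bm x) = (M_\lambda(\bm x))_{\lambda\in\Lambda}$. The true parameter is $\bm x^*$, $M^* = M(\bm x^* )$, and the $Y_\lambda$, $\lambda\in\Lambda$, are independent Bernoulli$(M^*_\lambda)$ variables. Each edge is observed independently with probability $\gamma\in(0,1]$, independently of $Y$; $\mathcal{S}\subset\Lambda$ is the random set of observed edges, so $n=\gamma N^2K$ is the expected number of observed edges. Put $C = \sup_{\bm u\in\mathcal{E}^2\times\mathcal{R}}|\phi(\bm u)|$; it is assumed throughout that $C\ge 2$. Estimator: the log-likelihood is $l(\bm x;Y_{\mathcal{S}})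 = \sum_{\lambda\in\mathcal{S}} \big[Y_\lambda\log M_\lambda(\bm x) + (1-Y_\lambda)\log(1-M_\lambda(\bm x))\big]$; $\hat{\bm x}$ is a maximizer of $l(\bm x;Y_{\mathcal{S}})$ over $\bm x\in\Theta$ (not necessarily unique), and $\hat M = M(\hat{\bm x})$. Loss: $L(\hat M,M^* ) = \frac{1}{|\Lambda|}\sum_{\lambda\in\Lambda} D(M^*_\lambda\|\hat M_\lambda)$. *)

(* Defs.v *)
From HB Require Import structures.
From mathcomp Require Import all_boot all_order all_algebra.
From mathcomp Require Import all_classical all_reals all_analysis.

Set Implicit Arguments.
Unset Strict Implicit.
Unset Printing Implicit Defensive.

Import Order.TTheory GRing.Theory Num.Theory.

Local Open Scope classical_set_scope.
Local Open Scope ring_scope.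

(* The library norm on matrices is the max norm, hence this definition. *)
Definition enorm (R : realType) (n : nat) (v : 'rV[R]_n) : R :=
  Num.sqrt (\sum_(i < n) v 0 i ^+ 2).

Definition eball (R : realType) (n : nat) (c : 'rV[R]_n) (r : R) :
    set 'rV[R]_n :=
  [set v | enorm (v - c) <= r].

Definition sigmoid (R : realType) (x : R) : R := expR x / (1 + expR x).

Definition KL (R : realType) (p q : R) : R :=
  p * ln (p / q) + (1 - p) * ln ((1 - p) / (1 - q)).

Definition hfun (R : realType) (u : R) : R := (1 + u^-1) * ln (1 + u) - 1.

Definition mutually_independent (d d' : measure_display)
    (T : measurableType d) (T' : measurableType d') (R : realType)
    (P : probability T R) (I : finType) (X : I -> {RV P >-> T'}) : Prop :=
  forall (J : {set I}) (B : I -> set T'),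
    (forall i, measurable (B i)) ->
    P (\bigcap_(i in [set j | j \in J]) X i @^-1` B i) =
    (\prod_(i in J) P (X i @^-1` B i))%E.

Definition edge (N K : nat) : finType := ('I_N * 'I_N * 'I_K)%type.

Definition param (R : realType) (N K dE dR : nat) : Type :=
  (('I_N -> 'rV[R]_dE) * ('I_K -> 'rV[R]_dR))%type.

Definition Theta (R : realType) (N K dE dR : nat)
    (E : set 'rV[R]_dE) (W : set 'rV[R]_dR) : set (param R N K dE dR) :=
  [set x | (forall i, E (x.1 i)) /\ (forall k, W (x.2 k))].

(* Triples (u, v, w) of E^2 x W are encoded as concatenated row vectors, so
   that enorm is the Euclidean norm on R^(dE + dE + dR). *)
Definition triple (R : realType) (dE dR : nat)
    (u v : 'rV[R]_dE) (w : 'rV[R]_dR) : 'rV[R]_(dE + dE + dR) :=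
  row_mx (row_mx u v) w.

Definition triples (R : realType) (dE dR : nat)
    (E : set 'rV[R]_dE) (W : set 'rV[R]_dR) : set 'rV[R]_(dE + dE + dR) :=
  [set z | exists u v w, [/\ E u, E v, W w & z = triple u v w]].

Definition edge_param (R : realType) (N K dE dR : nat)
    (x : param R N K dE dR) (l : edge N K) : 'rV[R]_(dE + dE + dR) :=
  triple (x.1 l.1.1) (x.1 l.1.2) (x.2 l.2).

Definition model (R : realType) (N K dE dR : nat)
    (phi : 'rV[R]_(dE + dE + dR) -> R) (x : param R N K dE dR)
    (l : edge N K) : R :=
  sigmoid (phi (edge_param x l)).

(* The real-valued sup is the true supremum only on nonempty bounded sets, and
   is 0 otherwise. *)
Definition score_bound (R : realType) (dE dR : nat)
    (phi : 'rV[R]_(dE + dE + dR) -> R)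
    (E : set 'rV[R]_dE) (W : set 'rV[R]_dR) : R :=
  sup [set `|phi z| | z in triples E W].

Definition loglik (R : realType) (N K dE dR : nat)
    (phi : 'rV[R]_(dE + dE + dR) -> R) (x : param R N K dE dR)
    (y : edge N K -> bool) (S : {set edge N K}) : R :=
  \sum_(l in S) ((y l)%:R * ln (model phi x l)
                 + (1 - (y l)%:R) * ln (1 - model phi x l)).

Definition is_mle (R : realType) (N K dE dR : nat)
    (phi : 'rV[R]_(dE + dE + dR) -> R)
    (E : set 'rV[R]_dE) (W : set 'rV[R]_dR)
    (y : edge N K -> bool) (S : {set edge N K})
    (xhat : param R N K dE dR) : Prop :=
  Theta E W xhat /\
  forall x, Theta E W x -> loglik phi x y S <= loglik phi xhat y S.

Definition loss (R : realType) (N K : nat) (Mhat Mstar : edge N K -> R) : R :=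
  (#|{: edge N K}|%:R)^-1 * \sum_(l : edge N K) KL (Mstar l) (Mhat l).

(* One family indexed by two copies of the edge set, so that its mutual
   independence says that labels and observation indicators are jointly
   independent. *)
Definition edge_data (d : measure_display) (T : measurableType d)
    (R : realType) (P : probability T R) (N K : nat)
    (Y Obs : edge N K -> {RV P >-> bool}) (i : edge N K + edge N K) :
    {RV P >-> bool} :=
  match i with inl l => Y l | inr l => Obs l end.

Definition observed (d : measure_display) (T : measurableType d)
    (R : realType) (P : probability T R) (N K : nat)
    (Obs : edge N K -> {RV P >-> bool}) (w : T) : {set edge N K} :=
  [set l | Obs l w]%SET.

(* Main.v *)
Require Import Defs.
From mathcomp Require Import all_boot all_order all_algebra.
From mathcomp Require Import all_classical all_reals all_analysis.
From mathcomp Require Import ring lra.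

(* For a fixed [x] with average loss at least [t], the log-likelihood ratio of
   [xstar] against [x] is a sum of independent terms [Z] with [`|Z| <= C] and
   [E Z ^+ 2 <= 2 * C * KL] (as [2 <= C]), so Bennett's argument bounds the
   probability that it is at most [s]. The maximum likelihood estimator is
   reduced to finitely many such [x] by a maximal separated subset of the bad
   parameters themselves: the net points then have loss at least [t], and only
   the likelihood, not the loss, has to be transferred from [xhat] to the net.
   The net has radius [s / (sqrt 3 * alpha * n * (1 + beta))], which costs at
   most [s] in log-likelihood unless more than [n * (1 + beta)] edges are
   observed, an event handled by a binomial Chernoff bound. The packing bound
   [(1 + 2 * U / delta) ^+ m] is obtained without volumes, by iterating a
   self-similar copy of the packing. *)

Set Implicit Arguments.
Unset Strict Implicit.
Unset Printing Implicit Defensive.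

Import Order.TTheory GRing.Theory Num.Theory.
Import numFieldNormedType.Exports.

Local Open Scope classical_set_scope.
Local Open Scope ring_scope.

(** * Bennett bounds for the exponential *)

Section exp_remainder.
Variable R : realType.
Implicit Types (f g : R -> R) (a l r s u x y z C : R).

Lemma nondecreasing_is_derive f g :
  (forall x, is_derive x 1 f (g x)) -> (forall x, 0 <= g x) ->
  {homo f : x y / x <= y}.
Proof.
move=> df g0 x y xy.
have derf z : derivable f z 1 := @ex_derive _ _ _ _ _ _ _ (df z).
have cf : {within `[x, y], continuous f}.
  apply: continuous_subspaceT => z.
  exact/differentiable_continuous/derivable1_diffP/derf.
apply: (@ger0_derive1_ndecr _ f x y) => // z _.
by have dz := df z; rewrite derive1E derive_val.
Qed.

Definition exp_rem x := expR x - 1 - x.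

Lemma exp_rem_ge0 x : 0 <= exp_rem x.
Proof. by rewrite /exp_rem; have := expR_ge1Dx x; lra. Qed.

(** The derivative is [exp_rem] itself. As the function vanishes at 0, this compares [exp_rem x]
    with [x ^+ 2 / 2] on each side of 0. *)
Lemma exp_rem_sub_sqr_homo : {homo (fun x => exp_rem x - x ^+ 2 / 2) : x y / x <= y}.
Proof.
apply: (@nondecreasing_is_derive _ (fun x => expR x - 1 - x)) => x; last first.
  exact: exp_rem_ge0.
rewrite /exp_rem; apply: is_derive_eq.
rewrite /GRing.scale /=; lra.
Qed.

Lemma expR_chord l x : 0 <= l <= 1 -> expR (l * x) <= l * expR x + (1 - l).
Proof.
move=> /andP[l0 l1].
have tangent z : expR (l * x) * (1 + z - l * x) <= expR z.
  have -> : expR z = expR (l * x) * expR (z - l * x) by rewrite -expRD; congr expR; ring.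
  by rewrite ler_wpM2l ?expR_ge0//; have := expR_ge1Dx (z - l * x); lra.
have := ler_wpM2l l0 (tangent x); have /(ler_wpM2l (_ : 0 <= 1 - l)) := tangent 0.
rewrite expR0 => /(_ ltac:(lra)); nra.
Qed.

(** The derivative is [l] times the gap between chord and exponential. The function vanishes at 0,
    so it has the sign of [x]. *)
Lemma exp_rem_scale_homo l : 0 <= l <= 1 ->
  {homo (fun x => l ^+ 2 * exp_rem x - exp_rem (l * x)) : x y / x <= y}.
Proof.
move=> l01; have /andP[l0 l1] := l01.
apply: (@nondecreasing_is_derive _
  (fun x => l * (l * expR x + (1 - l) - expR (l * x)))) => x; last first.
  by rewrite mulr_ge0// subr_ge0 expR_chord.
rewrite /exp_rem; apply: is_derive_eq.
rewrite /GRing.scale /=; ring.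
Qed.

Lemma exp_rem_scale_pos l x : 0 <= l <= 1 -> 0 <= x ->
  exp_rem (l * x) <= l ^+ 2 * exp_rem x.
Proof.
move=> l01 x0; have := exp_rem_scale_homo l01 x0.
by rewrite mulr0 /exp_rem expR0; lra.
Qed.

Lemma exp_rem_scale_neg l x : 0 <= l <= 1 -> x <= 0 ->
  l ^+ 2 * exp_rem x <= exp_rem (l * x).
Proof.
move=> l01 x0; have := exp_rem_scale_homo l01 x0.
by rewrite mulr0 /exp_rem expR0; lra.
Qed.

(* Cross-multiplied form of: [exp_rem x / x ^+ 2] is nondecreasing. *)
Lemma exp_rem_ratio_le x y : x <= y -> y ^+ 2 * exp_rem x <= x ^+ 2 * exp_rem y.
Proof.
move=> xy; have [y0|y0] := leP y 0.
  have [x0|x0] := eqVneq x 0.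
    have -> : y = 0 by lra.
    by rewrite x0.
  have yx : 0 <= y / x <= 1.
    by apply/andP; split; [rewrite ler_ndivlMr|rewrite ler_ndivrMr]; lra.
  have := exp_rem_scale_neg yx (le_trans xy y0).
  rewrite divfK// => /(ler_wpM2l (sqr_ge0 x)).
  by rewrite mulrA -exprMn mulrCA divff// mulr1.
(* For [x <= 0 < y] the value 1/2 separates the two ratios. *)
have [x0|x0] := leP x 0.
  have := exp_rem_sub_sqr_homo x0; have := exp_rem_sub_sqr_homo (ltW y0).
  rewrite /= /exp_rem expR0.
  set a := expR x - 1 - x; set b := expR y - 1 - y => hb ha.
  have {}hb : y ^+ 2 / 2 <= b by lra.
  have {}ha : a <= x ^+ 2 / 2 by lra.
  by have := ler_wpM2l (sqr_ge0 y) ha; have := ler_wpM2l (sqr_ge0 x) hb; lra.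
have xy1 : 0 <= x / y <= 1.
  by apply/andP; split; [rewrite ler_pdivlMr|rewrite ler_pdivrMr]; lra.
have := exp_rem_scale_pos xy1 (ltW y0).
rewrite divfK ?gt_eqF// => /(ler_wpM2l (sqr_ge0 y)).
by rewrite mulrA -exprMn mulrCA divff ?gt_eqF// mulr1.
Qed.

(* For a log-likelihood ratio [z], the mean of [exp_rem (- z)] is the KL
   divergence: its second moment is thus at most [2 * C] times its mean. *)
Lemma sqr_le_exp_rem C z : 2 <= C -> z <= C -> z ^+ 2 <= 2 * C * exp_rem (- z).
Proof.
move=> C2 zC; have : - C <= - z by lra.
move=> /exp_rem_ratio_le; rewrite !sqrrN => h.
(* Here [2 <= C] enters: [exp_rem (- C) >= C - 1 >= C / 2]. *)
have : C / 2 <= exp_rem (- C) by rewrite /exp_rem; have := expR_ge0 (- C); lra.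
move=> /(ler_wpM2l (sqr_ge0 z)) h2.
by rewrite -(@ler_pM2l _ (C / 2)); nra.
Qed.

(** The monotone ratio between [- (r * z)] and [r * C] bounds [exp_rem (- (r * z))] by
    [z ^+ 2 / C ^+ 2 * exp_rem (r * C)]. Then [z ^+ 2] is traded for [2 * C * exp_rem (- z)], so
    that taking means produces a divergence rather than a variance. *)
Lemma exp_mul_bernstein C r z : 2 <= C -> 0 <= r -> `|z| <= C ->
  expR (- (r * z)) <= 1 - r * z + 2 / C * exp_rem (r * C) * exp_rem (- z).
Proof.
move=> C2 r0; rewrite ler_norml => /andP[zC Cz].
have [->|rN0] := eqVneq r 0.
  by rewrite /exp_rem !mul0r oppr0 expR0 !addr0 subrr mulr0 mul0r addr0.
have r_gt0 : 0 < r by lra.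
have : r * (- z) <= r * C by rewrite ler_pM2l//; lra.
move=> /exp_rem_ratio_le; rewrite !exprMn sqrrN -!(mulrA (r ^+ 2)).
rewrite ler_pM2l ?exprn_gt0// mulrN => h.
have := ler_wpM2r (exp_rem_ge0 (r * C)) (sqr_le_exp_rem C2 Cz).
move=> h2; have h3 : C ^+ 2 * exp_rem (- (r * z)) <=
   C ^+ 2 * (2 / C * exp_rem (r * C) * exp_rem (- z)).
  apply: (le_trans h); apply: (le_trans h2); rewrite le_eqVlt; apply/orP; left.
  by apply/eqP; field; lra.
have C0 : 0 < C by lra.
move: h3; rewrite ler_pM2l ?exprn_gt0// {1}/exp_rem; lra.
Qed.

End exp_remainder.

(** * Log-likelihood ratios of sigmoids *)

Section sigmoid_likelihood.
Variable R : realType.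
Implicit Types (a b p q r s t u x z C : R) (y : bool).

Lemma sigmoid_gt0 x : 0 < sigmoid x.
Proof. by rewrite /sigmoid divr_gt0 ?addr_gt0 ?expR_gt0. Qed.

Lemma sigmoidN x : sigmoid (- x) = 1 - sigmoid x.
Proof.
rewrite /sigmoid expRN; have := expR_gt0 x; set e := expR x => e0.
by field; rewrite !gt_eqF ?addr_gt0.
Qed.

Lemma sigmoid_lt1 x : sigmoid x < 1.
Proof. by have := sigmoid_gt0 (- x); rewrite sigmoidN; lra. Qed.

Lemma ln_sigmoid_ratioC a b :
  ln (sigmoid a / sigmoid b) = - ln (sigmoid b / sigmoid a).
Proof. by rewrite -[in LHS]invf_div lnV// posrE divr_gt0 ?sigmoid_gt0. Qed.

Lemma ln_sigmoid_ratio_le a b z :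
  expR a * (1 + expR b) <= expR z * (expR b * (1 + expR a)) ->
  ln (sigmoid a / sigmoid b) <= z.
Proof.
move=> h; have pos x : 0 < 1 + expR x by rewrite addr_gt0 ?expR_gt0.
rewrite -ler_expR lnK; last by rewrite posrE divr_gt0 ?sigmoid_gt0.
rewrite ler_pdivrMr ?sigmoid_gt0// /sigmoid ler_pdivrMr//.
rewrite -(@ler_pM2r _ (1 + expR b))//.
apply: (le_trans h); rewrite le_eqVlt; apply/orP; left; apply/eqP.
by field; rewrite gt_eqF.
Qed.

(* Both [sigmoid a] and [sigmoid b] lie between [sigmoid (- C)] and
   [sigmoid C = expR C * sigmoid (- C)], whence [C] instead of the [2 * C] given
   by the Lipschitz bound. *)
Lemma ln_sigmoid_ratio_bound a b C : `|a| <= C -> `|b| <= C ->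
  `|ln (sigmoid a / sigmoid b)| <= C.
Proof.
suff h a' b' : `|a'| <= C -> `|b'| <= C -> ln (sigmoid a' / sigmoid b') <= C.
  by move=> aC bC; rewrite ler_norml lerNl -ln_sigmoid_ratioC !h.
rewrite !ler_norml => /andP[_ aC] /andP[bC _].
apply: ln_sigmoid_ratio_le.
have CB : 1 <= expR C * expR b' by rewrite -expRD -expR0 ler_expR; lra.
have AC : expR a' <= expR C by rewrite ler_expR.
have := ler_wpM2r (expR_ge0 a') CB; have := ler_wpM2r (expR_ge0 b') AC; lra.
Qed.

Lemma ln_sigmoid_lipschitz a b : ln (sigmoid a / sigmoid b) <= `|a - b|.
Proof.
apply: ln_sigmoid_ratio_le.
have AB : expR a <= expR `|a - b| * expR b.
  by rewrite -expRD ler_expR; have := ler_norm (a - b); lra.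
have d1 : 1 <= expR `|a - b| by rewrite -expR0 ler_expR.
have := ler_wpM2r (mulr_ge0 (expR_ge0 a) (expR_ge0 b)) d1; lra.
Qed.

Definition log_ratio p q y := if y then ln (p / q) else ln ((1 - p) / (1 - q)).

Lemma log_ratio_sigmoidE a b y : log_ratio (sigmoid a) (sigmoid b) y =
  ln (sigmoid (if y then a else - a) / sigmoid (if y then b else - b)).
Proof. by case: y => //=; rewrite !sigmoidN. Qed.

Lemma log_ratio_sigmoid_bound a b C y : `|a| <= C -> `|b| <= C ->
  `|log_ratio (sigmoid a) (sigmoid b) y| <= C.
Proof.
move=> aC bC; rewrite log_ratio_sigmoidE.
by apply: ln_sigmoid_ratio_bound; case: y; rewrite ?normrN.
Qed.

Lemma log_ratio_sigmoid_lipschitz a b y :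
  log_ratio (sigmoid a) (sigmoid b) y <= `|a - b|.
Proof.
rewrite log_ratio_sigmoidE; apply: (le_trans (ln_sigmoid_lipschitz _ _)).
by case: y => //; rewrite -opprD normrN.
Qed.

Lemma log_ratio_mgf p q C r : 0 < p < 1 -> 0 < q < 1 -> 2 <= C -> 0 <= r ->
  (forall y, `|log_ratio p q y| <= C) ->
  p * expR (- (r * log_ratio p q true))
    + (1 - p) * expR (- (r * log_ratio p q false))
  <= 1 - (r - 2 / C * exp_rem (r * C)) * KL p q.
Proof.
move=> /andP[p0 p1] /andP[q0 q1] C2 r0 hC.
(* For [y] of law Bernoulli [p], [expR (- log_ratio p q y)] has mean [q + (1 - q) = 1], so the
   linear part of [exp_rem] alone remains, with mean [KL p q]. *)
have KLE : KL p q = p * exp_rem (- log_ratio p q true)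
                    + (1 - p) * exp_rem (- log_ratio p q false).
  rewrite /exp_rem !expRN /= !lnK ?posrE ?divr_gt0 ?subr_gt0// /KL.
  by field; rewrite !gt_eqF ?subr_gt0.
have q0' : 0 <= 1 - p by lra.
have := ler_wpM2l (ltW p0) (exp_mul_bernstein C2 r0 (hC true)).
have := ler_wpM2l q0' (exp_mul_bernstein C2 r0 (hC false)).
have := congr1 ( *%R (2 / C * exp_rem (r * C))) KLE.
have : KL p q = p * log_ratio p q true + (1 - p) * log_ratio p q false by [].
move=> /(congr1 ( *%R r)).
move: (KL p q) (log_ratio p q) => k w; lra.
Qed.

Lemma ln1D_ge u : 0 <= u -> u / (1 + u) <= ln (1 + u).
Proof.
move=> u0; have := expR_ge1Dx (- ln (1 + u)).
rewrite expRN lnK ?posrE; last by lra.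
have -> : u / (1 + u) = 1 - (1 + u)^-1 by field; lra.
lra.
Qed.

Lemma exp_rem_ln1D u : 0 < 1 + u -> exp_rem (ln (1 + u)) = u - ln (1 + u).
Proof. by move=> u0; rewrite /exp_rem lnK ?posrE//; lra. Qed.

(* The value [r = ln (1 + u) / C] minimises the exponent when [m = a]. *)
Lemma chernoff_exponent C a s m u r : 2 <= C -> 0 < s < a -> a <= m ->
    u = 2^-1 - s / (2 * a) -> r = ln (1 + u) / C ->
  r * s - (r - 2 / C * exp_rem (r * C)) * m <= - ((a - s) / C * hfun u).
Proof.
move=> C2 /andP[s0 sa] am uE rE.
have a0 : 0 < a by lra.
have sE : s = a * (1 - 2 * u) by rewrite uE; field; lra.
have u0 : 0 < u by move: sa; rewrite sE; nra.
have u2 : u < 1 / 2 by move: s0; rewrite sE pmulr_rgt0//; lra.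
have rC : r * C = ln (1 + u) by rewrite rE; field; lra.
(* Since [u < 1 / 2], [u / (1 + u) >= 2 / 3 * u]. This is just enough for the coefficient of [m] to
   have the sign that allows replacing [m] by [a]. *)
have lnu : 2 / 3 * u <= ln (1 + u).
  apply: le_trans (ln1D_ge (ltW u0)); rewrite ler_pdivlMr; nra.
have g0 : 0 <= r - 2 / C * exp_rem (r * C).
  rewrite rC exp_rem_ln1D; last by lra.
  rewrite rE; have -> : ln (1 + u) / C - 2 / C * (u - ln (1 + u)) =
    (3 * ln (1 + u) - 2 * u) / C by field; lra.
  by rewrite divr_ge0; lra.
apply: (@le_trans _ _ (r * s - (r - 2 / C * exp_rem (r * C)) * a)).
  by rewrite lerD2l lerN2 ler_wpM2l.
rewrite rC exp_rem_ln1D; last by lra.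
rewrite le_eqVlt; apply/orP; left; apply/eqP.
rewrite rE /hfun {1 2}sE; field; lra.
Qed.

Lemma binomial_exponent n b : 0 < b ->
  n * b - ln (1 + b) * (n * (1 + b)) = - (n * b * hfun b).
Proof. by move=> b0; rewrite /hfun; field; lra. Qed.

End sigmoid_likelihood.

(** * Packings in a finite-dimensional normed space *)

Section packing.
Variables (R : realType) (V : lmodType R) (I : finType).
Variables (co : I -> V -> R) (nrm : V -> R) (c : R).
Hypothesis coB : forall i u v, co i (u - v) = co i u - co i v.
Hypothesis nrmD : forall u v, nrm (u + v) <= nrm u + nrm v.
Hypothesis nrmZ : forall a u, nrm (a *: u) = `|a| * nrm u.
Hypothesis co_le : forall i u, `|co i u| <= nrm u.
Hypothesis c_gt0 : 0 < c.
Hypothesis nrm_le : forall u e, 0 <= e -> (forall i, `|co i u| <= e) -> nrm u <= c * e.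

(** Bernoulli's inequality: if [b < a], the powers of [a / b] outgrow any [K]. This removes a
    multiplicative constant from a bound valid at all powers. *)
Lemma le_of_expr_le (a b K : R) : 0 < b -> 0 <= a ->
  (forall k, a ^+ k <= K * b ^+ k) -> a <= b.
Proof.
move=> b0 a0 h; rewrite leNgt; apply/negP => ba.
set x := a / b - 1.
have x0 : 0 < x by rewrite /x subr_gt0 ltr_pdivlMr// mul1r.
have bern k : 1 + k%:R * x <= (1 + x) ^+ k.
  elim: k => [|k IH]; first by rewrite mul0r addr0 expr0.
  rewrite exprS; apply: (@le_trans _ _ ((1 + x) * (1 + k%:R * x))); last first.
    by rewrite ler_wpM2l//; lra.
  by rewrite -natr1; have := mulr_ge0 (ler0n R k) (sqr_ge0 x); lra.
have xk k : (1 + x) ^+ k <= K.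
  have -> : 1 + x = a / b by rewrite /x; lra.
  by rewrite expr_div_n ler_pdivrMr ?exprn_gt0.
have := bern (Num.truncn (K / x)).+1; have := xk (Num.truncn (K / x)).+1.
have := truncnS_gt (K / x); rewrite ltr_pdivrMr//; lra.
Qed.

Let nrm0 : nrm 0 = 0.
Proof. by rewrite -(scale0r (0 : V)) nrmZ normr0 mul0r. Qed.

Let nrmN u : nrm (- u) = nrm u.
Proof. by rewrite -scaleN1r nrmZ normrN1 mul1r. Qed.

(** A crude count: rounding coordinates to a grid separates the points. The constants 4 and [c] are
    harmless, since [packing_card_le] applies it along powers. *)
Lemma separated_card_le (J : finType) (p : J -> V) (A e : R) :
  0 < e -> 0 <= A ->
  (forall j j', nrm (p j - p j') <= A) ->
  (forall j j', j != j' -> e <= nrm (p j - p j')) ->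
  #|J|%:R <= (4 * A * c / e + 1) ^+ #|I|.
Proof.
move=> e0 A0 pA pe.
have K0 : 0 <= 4 * A * c / e + 1.
  by rewrite addr_ge0// divr_ge0 ?(ltW e0)// mulr_ge0 ?(ltW c_gt0)// mulr_ge0.
have [j0 _|J0] := pickP (predT : pred J); last first.
  by rewrite (eq_card0 J0) exprn_ge0.
(* With this mesh, two points in one cell are at distance at most [c * eta = e / 2], less than the
   separation. *)
pose eta := e / (2 * c).
have eta0 : 0 < eta by rewrite /eta divr_gt0 ?mulr_gt0.
pose L := Num.truncn (2 * A / eta).
pose z j i := (co i (p j) - co i (p j0) + A) / eta.
have coA j i : `|co i (p j) - co i (p j0)| <= A by rewrite -coB (le_trans (co_le _ _)).
have z0 j i : 0 <= z j i.
  by rewrite divr_ge0 ?(ltW eta0)//; have := coA j i; rewrite ler_norml => /andP[]; lra.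
have zL j i : (Num.truncn (z j i) < L.+1)%N.
  rewrite ltnS; apply: le_truncn; rewrite ler_pM2r ?invr_gt0//.
  by have := coA j i; rewrite ler_norml => /andP[]; lra.
pose f j := [ffun i => Ordinal (zL j i)].
have f_inj : injective f.
  move=> j j' ff; apply/eqP/negPn/negP => /pe; apply/negP; rewrite -ltNge.
  apply: (@le_lt_trans _ _ (c * eta)); last first.
    have -> : c * eta = e / 2 by rewrite /eta; field; rewrite !gt_eqF.
    lra.
  apply: nrm_le => [|i]; first exact: ltW.
  have zz : Num.truncn (z j i) = Num.truncn (z j' i).
    by have /ffunP/(_ i) := ff; rewrite !ffunE => /(congr1 val).
  have := truncn_itv (z0 j i); have := truncn_itv (z0 j' i); rewrite zz.
  move=> /andP[h1 h2] /andP[h3 h4].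
  have : `|z j i - z j' i| <= 1.
    by rewrite ler_norml; rewrite -natr1 in h2 h4; apply/andP; split; lra.
  have -> : z j i - z j' i = co i (p j - p j') / eta.
    by rewrite coB /z; field; lra.
  by rewrite normrM normfV (gtr0_norm eta0) ler_pdivrMr// mul1r.
have : (#|J| <= L.+1 ^ #|I|)%N.
  by rewrite (leq_trans (leq_card f f_inj))// card_ffun card_ord.
rewrite -(ler_nat R) natrX => /le_trans; apply.
apply: lerXn2r; rewrite ?nnegrE// -natr1 lerD2r.
have -> : 4 * A * c / e = 2 * A / eta by rewrite /eta; field; rewrite !gt_eqF.
by rewrite /L truncn_le divr_ge0 ?(ltW eta0)// mulr_ge0.
Qed.

(* The similarities [y |-> p j + rho *: y] map a ball of radius [(L + delta) / 2]
   into itself with disjoint images when [rho = delta / (L + delta)]. Composing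
   [k] of them gives [#|J| ^ k] points at distance at least [delta * rho ^+ k], so
   the constants of [separated_card_le] disappear as [k] tends to infinity. *)
Lemma packing_card_le (J : finType) (p : J -> V) (L delta : R) :
  0 < delta -> 0 <= L ->
  (forall j j', nrm (p j - p j') <= L) ->
  (forall j j', j != j' -> delta <= nrm (p j - p j')) ->
  #|J|%:R <= (1 + L / delta) ^+ #|I|.
Proof.
move=> d0 L0 pL pd.
pose D := L + delta; pose rho := delta / D.
have D0 : 0 < D by rewrite /D; lra.
have rho0 : 0 < rho by rewrite divr_gt0.
have rho1 : rho <= 1 by rewrite ler_pdivrMr// /D; lra.
have rhoD : rho * D = delta by rewrite /rho; field; lra.
pose q := foldr (fun j v => p j + rho *: v) 0.
have qB j s j' s' : q (j :: s) - q (j' :: s') = (p j - p j') + rho *: (q s - q s').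
  by rewrite /= scalerBr; rewrite opprD addrACA.
(* Geometric sum: words of length [k] spread by at most [L * (1 + ... + rho ^+ k.-1)], and
   [L = D * (1 - rho)]. *)
have q_diam k (s s' : seq J) : size s = k -> size s' = k ->
    nrm (q s - q s') <= D * (1 - rho ^+ k).
  elim: k s s' => [|k IH] [|j s] [|j' s'] //.
    by rewrite subr0 nrm0 expr0 subrr mulr0.
  move=> [sk] [sk']; rewrite qB (le_trans (nrmD _ _))// nrmZ gtr0_norm//.
  have := ler_wpM2l (ltW rho0) (IH _ _ sk sk').
  have := pL j j'; rewrite exprS mulrA rhoD mulrBr mulr1 mulrBr mulrA [D * rho]mulrC rhoD.
  by rewrite /D; lra.
(* A common first letter scales distances by [rho]. Distinct first letters leave at least [delta -
   rho * D * (1 - rho ^+ k) = delta * rho ^+ k], as [rho * D = delta]. *)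
have q_sep k (s s' : seq J) : size s = k -> size s' = k -> s != s' ->
    delta * rho ^+ k <= nrm (q s - q s').
  elim: k s s' => [|k IH] [|j s] [|j' s'] //; move=> [sk] [sk'].
  rewrite eqseq_cons negb_and; have [->/= ss'|jj' _] := eqVneq j j'.
    rewrite qB subrr add0r nrmZ gtr0_norm// exprS mulrCA ler_pM2l//.
    exact: IH.
  have := pd _ _ jj'.
  have -> : p j - p j' = (q (j :: s) - q (j' :: s')) + rho *: (q s' - q s).
    by rewrite qB -addrA -scalerDr addrA subrK subrr scaler0 addr0.
  move=> /le_trans/(_ (nrmD _ _)); rewrite nrmZ gtr0_norm//.
  have := ler_wpM2l (ltW rho0) (q_diam _ _ _ sk' sk).
  rewrite mulrA rhoD mulrBr mulr1.
  have : rho ^+ k.+1 <= rho ^+ k by rewrite exprS ger_pMl ?exprn_gt0.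
  by move=> /(ler_wpM2l (ltW d0)); lra.
have rhoV : 1 + L / delta = rho^-1 by rewrite /rho /D; field; rewrite !gt_eqF.
rewrite rhoV; set m := #|I|.
apply: (@le_of_expr_le _ _ ((4 * D * c / delta + 1) ^+ m)) => [|//|k].
  by rewrite exprn_gt0 ?invr_gt0.
have rk0 : 0 < rho ^+ k by rewrite exprn_gt0.
have := @separated_card_le {: k.-tuple J} (fun s => q s) D (delta * rho ^+ k).
rewrite card_tuple natrX; move=> h.
apply: (le_trans (h _ _ _ _)).
- by rewrite mulr_gt0.
- exact: ltW.
- move=> s s'; rewrite (le_trans (q_diam k _ _ (size_tuple _) (size_tuple _)))//.
  by rewrite ger_pMr//; lra.
- by move=> s s' ss'; apply: q_sep; rewrite ?size_tuple.
have Dc0 : 0 <= 4 * D * c by rewrite !mulr_ge0// ltW.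
rewrite exprAC -exprMn; apply: lerXn2r; rewrite ?nnegrE.
- by rewrite addr_ge0// divr_ge0// ltW// mulr_gt0.
- by rewrite mulr_ge0 ?addr_ge0 ?divr_ge0 ?exprn_ge0 ?invr_ge0 ?(ltW d0) ?(ltW rho0).
(* The factor [(rho ^+ k)^-1] absorbs the summand 1, leaving a constant independent of [k]. *)
- have r1 : 1 <= (rho ^+ k)^-1 by rewrite invf_ge1// exprn_ile1// ltW.
  by move: (4 * D * c) => K; rewrite exprVn mulrDl mul1r lerD// -mulrA -invfM.
Qed.

(** A separated family of maximal size in [A] is a net: a point far from all its members could be
    added. A maximum exists because [packing_card_le] bounds the size. *)
Lemma exists_net (A : set V) (L delta : R) : 0 < delta -> 0 <= L ->
  (forall u v, A u -> A v -> nrm (u - v) <= L) ->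
  exists M (p : 'I_M -> V), [/\ M%:R <= (1 + L / delta) ^+ #|I|,
    forall j, A (p j) & forall u, A u -> exists j, nrm (u - p j) <= delta].
Proof.
move=> d0 L0 AL.
pose packs M (p : 'I_M -> V) := (forall j, A (p j)) /\
  (forall j j', j != j' -> delta <= nrm (p j - p j')).
pose P M := `[< exists p, @packs M p >].
have packs_le M p : @packs M p -> M%:R <= (1 + L / delta) ^+ #|I|.
  by move=> [pA pd]; rewrite -[in M%:R](card_ord M);
    apply: (packing_card_le d0 L0 _ pd) => j j'; apply: AL.
have exP : exists M, P M.
  exists 0%N; apply/asboolP; exists (fun _ => 0).
  by split=> -[].
have leP M : P M -> (M <= Num.truncn ((1 + L / delta) ^+ #|I|))%N.
  move=> /asboolP[p /packs_le]; rewrite truncn_ge_nat//.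
  by rewrite exprn_ge0// addr_ge0// divr_ge0// ltW.
case: (ex_maxnP exP leP) => M /asboolP[p pP] maxM.
exists M, p; split; [exact: packs_le pP|by case: pP|].
move=> u Au; apply: contrapT => /forallNP far.
suff /maxM : P M.+1 by rewrite ltnn.
have far' j : delta <= nrm (u - p j) by rewrite ltW// ltNge; apply/negP/far.
apply/asboolP; exists (fun i => if unlift ord_max i is Some j then p j else u).
case: pP => pA pd; split=> [j|j j']; first by case: unliftP.
case: unliftP => [i ->|->]; case: unliftP => [i' ->|->]; rewrite ?eqxx//.
- by rewrite (inj_eq lift_inj); apply: pd.
- by rewrite -nrmN opprB.
Qed.

End packing.

(** * Euclidean norm of vectors and of concatenated triples *)

Section euclidean_norm.
Variable R : realType.

Let sum_sqr_ge0 n (u : 'rV[R]_n) : 0 <= \sum_(i < n) u 0 i ^+ 2.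
Proof. by apply: sumr_ge0 => i _; exact: sqr_ge0. Qed.

Lemma enorm_ge0 n (u : 'rV[R]_n) : 0 <= enorm u.
Proof. exact: sqrtr_ge0. Qed.

Lemma sqr_enorm n (u : 'rV[R]_n) : enorm u ^+ 2 = \sum_(i < n) u 0 i ^+ 2.
Proof. by rewrite sqr_sqrtr. Qed.

(** Cauchy-Schwarz, by expanding the squared norm of [b *: u - a *: v] with [a], [b] the norms of
    [u], [v]. Dividing by [2 * (a * b)] leaves zero norms as a separate case. *)
Lemma dotmul_le_enorm n (u v : 'rV[R]_n) :
  \sum_(i < n) u 0 i * v 0 i <= enorm u * enorm v.
Proof.
set a := enorm u; set b := enorm v.
have sq : 0 <= \sum_(i < n) (b * u 0 i - a * v 0 i) ^+ 2.
  by apply: sumr_ge0 => i _; exact: sqr_ge0.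
have expand : \sum_(i < n) (b * u 0 i - a * v 0 i) ^+ 2 =
    2 * (a * b) * (a * b - \sum_(i < n) u 0 i * v 0 i).
  transitivity (b ^+ 2 * \sum_(i < n) u 0 i ^+ 2 + a ^+ 2 * \sum_(i < n) v 0 i ^+ 2
      - 2 * (a * b) * \sum_(i < n) u 0 i * v 0 i); last first.
    by rewrite -!sqr_enorm -/a -/b; ring.
  rewrite !mulr_sumr -big_split /= -sumrB; apply: eq_bigr => i _; ring.
have a0 : 0 <= a := enorm_ge0 u; have b0 : 0 <= b := enorm_ge0 v.
have zero m (w z : 'rV[R]_m) : enorm w = 0 -> \sum_(i < m) w 0 i * z 0 i = 0.
  move=> w0; have /eqP := sqr_enorm w; rewrite w0 expr0n eq_sym psumr_eq0.
    by move=> /allP w00; apply: big1 => i _; have := w00 i (mem_index_enum i);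
      rewrite sqrf_eq0 => /eqP ->; rewrite mul0r.
  by move=> i _; exact: sqr_ge0.
have [a00|aN0] := eqVneq a 0; first by rewrite zero// mulr_ge0.
have [b00|bN0] := eqVneq b 0.
  by under eq_bigr do rewrite mulrC; rewrite zero// mulr_ge0.
have ab : 0 < 2 * (a * b) by rewrite !mulr_gt0// lt_def ?aN0 ?bN0.
by move: sq; rewrite expand pmulr_rge0// subr_ge0.
Qed.

Lemma enormD n (u v : 'rV[R]_n) : enorm (u + v) <= enorm u + enorm v.
Proof.
rewrite -(@ler_pXn2r _ 2)// ?nnegrE ?addr_ge0 ?enorm_ge0// sqr_enorm sqrrD !sqr_enorm.
have -> : \sum_(i < n) (u + v) 0 i ^+ 2 = \sum_(i < n) u 0 i ^+ 2
    + 2 * (\sum_(i < n) u 0 i * v 0 i) + \sum_(i < n) v 0 i ^+ 2.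
  rewrite mulr_sumr -!big_split /=; apply: eq_bigr => i _; rewrite mxE; ring.
have := dotmul_le_enorm u v; rewrite -mulr_natl; lra.
Qed.

Lemma enormZ n a (u : 'rV[R]_n) : enorm (a *: u) = `|a| * enorm u.
Proof.
rewrite -sqrtr_sqr /enorm -sqrtrM ?sqr_ge0// mulr_sumr; congr Num.sqrt.
by apply: eq_bigr => i _; rewrite mxE exprMn.
Qed.

Lemma enormB n (u v : 'rV[R]_n) : enorm (u - v) = enorm (v - u).
Proof. by rewrite -opprB -scaleN1r enormZ normrN1 mul1r. Qed.

Lemma enorm_coord_le n (u : 'rV[R]_n) i : `|u 0 i| <= enorm u.
Proof.
rewrite -sqrtr_sqr ler_wsqrtr// (bigD1 i)//= lerDl.
by apply: sumr_ge0 => j _; exact: sqr_ge0.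
Qed.

(** The factor [n.+1] is cruder than the square root of [n], but it is positive even for [n = 0] and
    vanishes from the packing bound anyway. *)
Lemma enorm_le_coord n (u : 'rV[R]_n) e : 0 <= e ->
  (forall i, `|u 0 i| <= e) -> enorm u <= n.+1%:R * e.
Proof.
move=> e0 ue; rewrite -(@ler_pXn2r _ 2)// ?nnegrE ?mulr_ge0 ?enorm_ge0//.
rewrite sqr_enorm; apply: (@le_trans _ _ (\sum_(i < n) e ^+ 2)).
  by apply: ler_sum => i _; rewrite -real_normK ?num_real// lerXn2r ?nnegrE.
rewrite sumr_const card_ord -[_ *+ n]mulr_natl exprMn ler_wpM2r ?sqr_ge0//.
by rewrite -natrX ler_nat expnS expn1 (leq_trans (leqnSn n))// leq_pmulr.
Qed.

Lemma eball_diam n (x : 'rV[R]_n) r u v : eball x r u -> eball x r v ->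
  enorm (u - v) <= 2 * r.
Proof.
rewrite /eball /= => ur vr.
have -> : u - v = (u - x) + (x - v) by rewrite addrA subrK.
by apply: (le_trans (enormD _ _)); rewrite (enormB x); lra.
Qed.

(** Three blocks of norm at most [r]: the source of the factor [Num.sqrt 3] in the theorem. *)
Lemma enorm_triple_le dE dR (u v : 'rV[R]_dE) (w : 'rV[R]_dR) r :
  enorm u <= r -> enorm v <= r -> enorm w <= r ->
  enorm (triple u v w) <= Num.sqrt 3 * r.
Proof.
move=> ur vr wr; have r0 : 0 <= r by rewrite (le_trans (enorm_ge0 u)).
have sqr_le n (z : 'rV[R]_n) : enorm z <= r -> enorm z ^+ 2 <= r ^+ 2.
  by move=> zr; rewrite lerXn2r ?nnegrE ?enorm_ge0.
rewrite -(@ler_pXn2r _ 2)// ?nnegrE ?mulr_ge0 ?enorm_ge0 ?sqrtr_ge0//.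
rewrite exprMn sqr_enorm [Num.sqrt _ ^+ 2]sqr_sqrtr// /triple.
rewrite big_split_ord /= big_split_ord /=.
under eq_bigr do rewrite row_mxEl row_mxEl.
under [in X in _ + X + _]eq_bigr do rewrite row_mxEl row_mxEr.
under [in X in _ + _ + X]eq_bigr do rewrite row_mxEr.
rewrite -!sqr_enorm.
by have := sqr_le _ _ ur; have := sqr_le _ _ vr; have := sqr_le _ _ wr; lra.
Qed.

Lemma tripleB dE dR (u v u' v' : 'rV[R]_dE) (w w' : 'rV[R]_dR) :
  triple u v w - triple u' v' w' = triple (u - u') (v - v') (w - w').
Proof. by rewrite /triple !opp_row_mx !add_row_mx. Qed.

End euclidean_norm.

(** * Nets in the parameter set *)

Section parameter_net.
Variables (R : realType) (N K dE dR : nat).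
Local Notation V := (('I_N -> 'rV[R]_dE) * ('I_K -> 'rV[R]_dR))%type.

(** With a maximum over blocks, a product of balls of radius [U] is again a ball of radius [U], and
    closeness is uniform over all edges. *)
Definition param_norm (x : V) : R :=
  Num.max (\big[Num.max/0]_(i < N) enorm (x.1 i)) (\big[Num.max/0]_(k < K) enorm (x.2 k)).

Lemma param_norm_le (x : V) r : 0 <= r -> (param_norm x <= r) <->
  (forall i, enorm (x.1 i) <= r) /\ (forall k, enorm (x.2 k) <= r).
Proof.
move=> r0; rewrite /param_norm ge_max; split=> [/andP[h1 h2]|[h1 h2]].
  by split=> i; [apply: le_trans h1|apply: le_trans h2]; exact: le_bigmax.
by rewrite !bigmax_le.
Qed.

Lemma param_norm_ge0 x : 0 <= param_norm x.
Proof. by rewrite /param_norm le_max bigmax_ge_id. Qed.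

Lemma enorm_le_param_norm (x : V) :
  (forall i, enorm (x.1 i) <= param_norm x) /\ (forall k, enorm (x.2 k) <= param_norm x).
Proof. by apply/param_norm_le; rewrite ?param_norm_ge0. Qed.

(** The index type has [N * dE + K * dR] elements, which is the exponent of the packing bound. *)
Definition param_coord (i : 'I_N * 'I_dE + 'I_K * 'I_dR) (x : V) : R :=
  match i with inl ij => x.1 ij.1 0 ij.2 | inr kj => x.2 kj.1 0 kj.2 end.

Lemma param_normD (x y : V) : param_norm (x + y) <= param_norm x + param_norm y.
Proof.
have [x1 x2] := enorm_le_param_norm x; have [y1 y2] := enorm_le_param_norm y.
apply/param_norm_le; first by rewrite addr_ge0 ?param_norm_ge0.
by split=> i; rewrite (le_trans (enormD _ _))// lerD.
Qed.

Lemma param_normZ a (x : V) : param_norm (a *: x) = `|a| * param_norm x.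
Proof.
have le b (y : V) : param_norm (b *: y) <= `|b| * param_norm y.
  have [y1 y2] := enorm_le_param_norm y.
  apply/param_norm_le; first by rewrite mulr_ge0 ?param_norm_ge0.
  by split=> i; rewrite enormZ ler_wpM2l.
have [->|a0] := eqVneq a 0.
  apply/eqP; rewrite eq_le le normr0 mul0r param_norm_ge0//.
apply/eqP; rewrite eq_le le/=.
have := le a^-1 (a *: x); rewrite scalerA mulVf// scale1r normfV.
by rewrite ler_pdivlMl ?normr_gt0.
Qed.

Lemma param_net (U delta : R) (cE : 'rV[R]_dE) (cR : 'rV[R]_dR)
    (A : set (param R N K dE dR)) : 0 <= U -> 0 < delta ->
  A `<=` Theta (eball cE U) (eball cR U) ->
  exists M (p : 'I_M -> param R N K dE dR),
    [/\ M%:R <= (1 + 2 * U / delta) ^+ (N * dE + K * dR), forall j, A (p j) &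
     forall x, A x -> exists j, (forall i, enorm (x.1 i - (p j).1 i) <= delta) /\
       (forall k, enorm (x.2 k - (p j).2 k) <= delta)].
Proof.
move=> U0 d0 AT.
have co_le i (x : V) : `|param_coord i x| <= param_norm x.
  have [x1 x2] := enorm_le_param_norm x.
  by case: i => [[i j]|[k j]] /=; rewrite (le_trans (enorm_coord_le _ _)).
have le_co (x : V) e : 0 <= e -> (forall i, `|param_coord i x| <= e) ->
    param_norm x <= (dE + dR).+1%:R * e.
  move=> e0 xe; apply/param_norm_le; first by rewrite mulr_ge0.
  split=> i.
    apply: (le_trans (@enorm_le_coord _ _ (x.1 i) e e0 (fun j => xe (inl (i, j))))).
    by rewrite ler_wpM2r// ler_nat ltnS leq_addr.
  apply: (le_trans (@enorm_le_coord _ _ (x.2 i) e e0 (fun j => xe (inr (i, j))))).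
  by rewrite ler_wpM2r// ler_nat ltnS leq_addl.
have coB i (x y : V) : param_coord i (x - y) = param_coord i x - param_coord i y.
  by case: i => [[i j]|[k j]]; rewrite /= !mxE.
have U20 : 0 <= 2 * U by rewrite mulr_ge0.
have AL (x y : V) : A x -> A y -> param_norm (x - y) <= 2 * U.
  move=> /AT[x1 x2] /AT[y1 y2]; apply/param_norm_le => //.
  by split=> i; apply: eball_diam.
have [|M [p [pM pA pnet]]] :=
  exists_net coB param_normD param_normZ co_le _ le_co d0 U20 AL; first by rewrite ltr0n.
exists M, p; split => //.
  by move: pM; rewrite card_sum !card_prod !card_ord.
by move=> x /pnet[j /(param_norm_le _ (ltW d0))]; exists j.
Qed.

End parameter_net.

(** * Deviations on a finite product space *)

Section finite_chernoff.
Variables (R : realType) (I J : finType).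
Variables (w : I -> J -> R).
Hypothesis w_ge0 : forall i j, 0 <= w i j.

Let prod_w (f : {ffun I -> J}) := \prod_i w i (f i).

Let prod_w_ge0 f : 0 <= prod_w f.
Proof. by apply: prodr_ge0. Qed.

(** Markov's inequality for the exponential: the moment of the sum factorises over [I], and each
    factor is at most [1 + x i <= expR (x i)]. *)
Lemma finite_chernoff (Q : pred {ffun I -> J}) (g : I -> J -> R) (x : I -> R) (c : R) :
  (forall f, Q f -> c <= \sum_i g i (f i)) ->
  (forall i, \sum_j w i j * expR (g i j) <= 1 + x i) ->
  \sum_(f | Q f) prod_w f <= expR (\sum_i x i - c).
Proof.
move=> Qc wx.
apply: (@le_trans _ _ (\sum_(f : {ffun I -> J}) prod_w f * expR (\sum_i g i (f i) - c))).
  rewrite big_mkcond /=; apply: ler_sum => f _; case: ifPn => Qf.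
    rewrite -[leLHS]mulr1 ler_wpM2l// -expR0 ler_expR subr_ge0; exact: Qc.
  by rewrite mulr_ge0 ?expR_ge0.
have -> : \sum_(f : {ffun I -> J}) prod_w f * expR (\sum_i g i (f i) - c) =
    expR (- c) * \prod_i \sum_j w i j * expR (g i j).
  rewrite bigA_distr_bigA mulr_sumr; apply: eq_bigr => f _.
  by rewrite expRD expR_sum big_split /= mulrA mulrC.
rewrite addrC expRD ler_wpM2l ?expR_ge0// expR_sum.
apply: ler_prod => i _; apply/andP; split.
  by apply: sumr_ge0 => j _; rewrite mulr_ge0 ?expR_ge0.
by rewrite (le_trans (wx i))// expR_ge1Dx.
Qed.

Lemma finite_union_bound (M : nat) (Q Q' : pred {ffun I -> J})
    (Qs : 'I_M -> pred {ffun I -> J}) :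
  (forall f, Q f -> Q' f \/ exists k, Qs k f) ->
  \sum_(f | Q f) prod_w f <=
  \sum_(k < M) \sum_(f | Qs k f) prod_w f + \sum_(f | Q' f) prod_w f.
Proof.
move=> QQ.
have -> : \sum_(k < M) \sum_(f | Qs k f) prod_w f =
    \sum_(f : {ffun I -> J}) \sum_(k < M) (if Qs k f then prod_w f else 0).
  by rewrite exchange_big; apply: eq_bigr => k _; rewrite big_mkcond.
rewrite [leLHS]big_mkcond [X in _ + X]big_mkcond -big_split /=.
apply: ler_sum => f _.
have s0 (P : pred 'I_M) : 0 <= \sum_(k < M | P k) (if Qs k f then prod_w f else 0).
  by apply: sumr_ge0 => k _; case: ifP.
case: ifPn => [/QQ[Q'f|[k Qk]]|_]; last by rewrite addr_ge0//; case: ifP.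
  by rewrite Q'f lerDr s0.
by rewrite (bigD1 k)//= Qk -addrA lerDl addr_ge0//; case: ifP.
Qed.

End finite_chernoff.

(** * Law of the labels and observation indicators *)

Section configuration.
Variables (R : realType) (N K : nat).
Variables (d : measure_display) (T : measurableType d) (P : probability T R).
Variables (Y Obs : edge N K -> {RV P >-> bool}).
Variables (p : edge N K -> R) (gamma : R).
Hypothesis p01 : forall l, 0 <= p l <= 1.
Hypothesis gamma01 : 0 <= gamma <= 1.
Hypothesis hY : forall l, distribution P (Y l) =1 bernoulli_prob (p l).
Hypothesis hO : forall l, distribution P (Obs l) =1 bernoulli_prob gamma.
Hypothesis hind : mutually_independent (edge_data Y Obs).

(** Labels of unobserved edges are kept too: each fibre is then an intersection of independent
    events, and the law is a product. *)
Definition config (w : T) : {ffun edge N K -> bool * bool} := [ffun l => (Y l w, Obs l w)].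

Lemma bernoulli_prob1 (q : R) b : 0 <= q <= 1 ->
  bernoulli_prob q [set b] = (bernoulli_pmf q b)%:E.
Proof.
move=> q01; rewrite bernoulli_probE// !diracE.
have memE c : (c \in [set b]%classic) = (c == b) by apply/idP/eqP; rewrite inE.
by rewrite !memE; case: b {memE}; rewrite /= ?mule1 ?mule0 ?adde0 ?add0e.
Qed.

Let config_event f (i : edge N K + edge N K) : set bool :=
  match i with inl l => [set (f l).1] | inr l => [set (f l).2] end.

Let config_fiberE (f : {ffun edge N K -> bool * bool}) :
  [set w | config w = f] =
  \bigcap_(i in [set j | j \in [set: edge N K + edge N K]%SET])
    edge_data Y Obs i @^-1` config_event f i.
Proof.
apply/seteqP; split=> w /=.
  by move=> <- [l|l] _ /=; rewrite ffunE.
move=> h; apply/ffunP => l; rewrite ffunE [RHS]surjective_pairing.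
by congr pair; [apply: (h (inl l))|apply: (h (inr l))]; rewrite /= finset.in_setT.
Qed.

Lemma measurable_config f : measurable [set w | config w = f].
Proof.
rewrite config_fiberE; apply: fin_bigcap_measurable => // i _.
exact: measurable_funPTI.
Qed.

Lemma prob_config f : P [set w | config w = f] =
  (\prod_l (bernoulli_pmf (p l) (f l).1 * bernoulli_pmf gamma (f l).2))%:E.
Proof.
rewrite config_fiberE hind//.
transitivity (\prod_(i : edge N K + edge N K) P (edge_data Y Obs i @^-1` config_event f i))%E.
  by apply: eq_bigl => i; rewrite finset.in_setT.
rewrite big_sumType /= big_split /= EFinM -!prodEFin.
by congr (_ * _)%E; apply: eq_bigr => l _;
  [rewrite -bernoulli_prob1// -hY|rewrite -bernoulli_prob1// -(hO l)].
Qed.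

(** Only an inclusion is asked: [A] need not be a union of fibres of [config], as the estimator may
    choose differently among maximizers at outcomes with the same data. *)
Lemma prob_le_config (A : set T) (Q : pred {ffun edge N K -> bool * bool}) :
  measurable A -> (forall w, A w -> Q (config w)) ->
  (P A <= (\sum_(f | Q f)
    \prod_l (bernoulli_pmf (p l) (f l).1 * bernoulli_pmf gamma (f l).2))%:E)%E.
Proof.
move=> mA AQ.
rewrite -sumEFin; set S := \big[setU/set0]_(f | Q f) [set w | config w = f].
suff [mS PS] : measurable S /\ (P S <= \sum_(f | Q f)
    (\prod_l (bernoulli_pmf (p l) (f l).1 * bernoulli_pmf gamma (f l).2))%:E)%E.
  apply: le_trans PS; rewrite le_measure ?inE// => w Aw.
  by rewrite /S -bigcup_pred; exists (config w) => //=; exact: AQ.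
rewrite /S; elim/big_rec2: _ => [|f B y Qf [mB PB]]; first by rewrite measure0.
have mf := measurable_config f; split; first exact: measurableU.
apply: (le_trans (measureU2 _ mf mB)); apply: leeD => //.
by rewrite -prob_config.
Qed.

End configuration.

(** * Deviations of the likelihood ratio and of the number of observed edges *)

Section deviation.
Variables (R : realType) (I : finType).
Variables (p : I -> R) (gamma : R).
Hypothesis p01 : forall i, 0 < p i < 1.
Hypothesis gamma01 : 0 < gamma <= 1.

Let w i (b : bool * bool) := bernoulli_pmf (p i) b.1 * bernoulli_pmf gamma b.2.

Let w_ge0 i b : 0 <= w i b.
Proof.
have /andP[g0 g1] := gamma01; have /andP[p0 p1] := p01 i.
by rewrite /w mulr_ge0// bernoulli_pmf_ge0 ?(ltW p0) ?(ltW p1) ?(ltW g0).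
Qed.

Let sum_w i (F : bool * bool -> R) : \sum_b w i b * F b =
  p i * (gamma * F (true, true) + (1 - gamma) * F (true, false))
  + (1 - p i) * (gamma * F (false, true) + (1 - gamma) * F (false, false)).
Proof.
transitivity (\sum_a \sum_b w i (a, b) * F (a, b)).
  by rewrite pair_bigA; apply: eq_bigr => -[].
by rewrite !big_bool /w /=; ring.
Qed.

Lemma likelihood_deviation (q : I -> R) (C a s u : R) :
  (forall i, 0 < q i < 1) -> (forall i y, `|log_ratio (p i) (q i) y| <= C) ->
  2 <= C -> 0 < s < a -> a <= gamma * \sum_i KL (p i) (q i) ->
  u = 2^-1 - s / (2 * a) ->
  \sum_(f : {ffun I -> bool * bool} |
      \sum_i (if (f i).2 then log_ratio (p i) (q i) (f i).1 else 0) <= s)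
    \prod_i (bernoulli_pmf (p i) (f i).1 * bernoulli_pmf gamma (f i).2)
  <= expR (- ((a - s) / C * hfun u)).
Proof.
move=> q01 lrC C2 sa aKL uE; pose r := ln (1 + u) / C.
have r0 : 0 <= r.
  rewrite divr_ge0//; last by lra.
  rewrite ln_ge0// uE; have /andP[s0 s1] := sa.
  have : s / (2 * a) <= 1 / 2 by rewrite ler_pdivrMr; lra.
  lra.
(* An unobserved edge contributes a factor 1, so averaging over the observation multiplies the
   deficit [rate * KL (p i) (q i)] by [gamma]. *)
pose g i (b : bool * bool) := if b.2 then - (r * log_ratio (p i) (q i) b.1) else 0.
pose rate := r - 2 / C * exp_rem (r * C).
have := @finite_chernoff R I _ w w_ge0 _ g
  (fun i => - (gamma * rate * KL (p i) (q i))) (- (r * s)).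
move=> /(_ (fun f => \sum_i (if (f i).2 then log_ratio (p i) (q i) (f i).1 else 0) <= s)).
move=> h; apply: (le_trans (h _ _)) => [f fs|i|].
- have -> : \sum_i g i (f i) =
      - (r * \sum_i (if (f i).2 then log_ratio (p i) (q i) (f i).1 else 0)).
    rewrite mulr_sumr -sumrN; apply: eq_bigr => i _.
    by rewrite /g; case: ifP => //; rewrite mulr0 oppr0.
  by rewrite lerN2 ler_wpM2l.
- rewrite sum_w /g /= expR0.
  have := log_ratio_mgf (p01 i) (q01 i) C2 r0 (lrC i); rewrite -/rate.
  have /andP[g0 g1] := gamma01 => /(ler_wpM2l (ltW g0)).
  rewrite /log_ratio /=; lra.
- rewrite ler_expR sumrN -mulr_sumr.
  have := chernoff_exponent C2 sa aKL uE erefl; rewrite -/r -/rate; lra.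
Qed.

(** With [r = ln (1 + b)], an observation indicator has exponential moment exactly
    [1 + gamma * b]. *)
Lemma observation_deviation (b n : R) : 0 < b -> n = gamma * #|I|%:R ->
  \sum_(f : {ffun I -> bool * bool} | n * (1 + b) <= \sum_i (f i).2%:R)
    \prod_i (bernoulli_pmf (p i) (f i).1 * bernoulli_pmf gamma (f i).2)
  <= expR (- (n * b * hfun b)).
Proof.
move=> b0 nE; pose r := ln (1 + b).
have r0 : 0 <= r by rewrite ln_ge0//; lra.
pose g (i : I) (y : bool * bool) := if y.2 then r else 0.
have := @finite_chernoff R I _ w w_ge0 _ g (fun i => gamma * b) (r * (n * (1 + b))).
move=> /(_ (fun f => n * (1 + b) <= \sum_i (f i).2%:R)).
move=> h; apply: (le_trans (h _ _)) => [f fs|i|].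
- have -> : \sum_i g i (f i) = r * \sum_i (f i).2%:R.
    rewrite mulr_sumr; apply: eq_bigr => i _.
    by rewrite /g; case: (f i).2; rewrite ?mulr1 ?mulr0.
  by rewrite ler_wpM2l.
- rewrite sum_w /g /= expR0 /r lnK ?posrE; last by lra.
  by rewrite le_eqVlt; apply/orP; left; apply/eqP; ring.
- have -> : \sum_(i : I) gamma * b = n * b.
    rewrite nE -sum1_card natr_sum mulr_sumr mulr_suml.
    by apply: eq_big => // i _; rewrite mulr1.
  by rewrite -binomial_exponent.
Qed.

End deviation.

(** * Likelihood, score bound and loss in the network model *)

Section network_model.
Variables (R : realType) (N K dE dR : nat).
Variable phi : 'rV[R]_(dE + dE + dR) -> R.
Implicit Types (x : param R N K dE dR) (E : set 'rV[R]_dE) (W : set 'rV[R]_dR).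

Lemma model01 x l : 0 < model phi x l < 1.
Proof. by rewrite /model sigmoid_gt0 sigmoid_lt1. Qed.

Lemma loglikB x x' y (S : {set edge N K}) :
  loglik phi x y S - loglik phi x' y S =
  \sum_(l in S) log_ratio (model phi x l) (model phi x' l) (y l).
Proof.
rewrite /loglik -sumrB; apply: eq_bigr => l _.
have /andP[p0 p1] := model01 x l; have /andP[q0 q1] := model01 x' l.
by case: (y l); rewrite /= [RHS]ln_div ?posrE ?subr_gt0//; ring.
Qed.

Lemma triples_edge_param E W x l : Theta E W x -> triples E W (edge_param x l).
Proof. by move=> [xE xW]; exists (x.1 l.1.1), (x.1 l.1.2), (x.2 l.2). Qed.

(** The supremum is genuine: on an empty or unbounded set it would be 0, against
    [2 <= score_bound phi E W]. *)
Lemma score_bound_ge E W z : 2 <= score_bound phi E W -> triples E W z ->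
  `|phi z| <= score_bound phi E W.
Proof.
move=> hC Ez; apply: ub_le_sup; last by exists z.
have [[]//|/sup_out s0] := pselect (has_sup [set `|phi z| | z in triples E W]).
by move: hC; rewrite /score_bound s0; lra.
Qed.

Lemma log_ratio_model_bound E W x x' l y : 2 <= score_bound phi E W ->
  Theta E W x -> Theta E W x' ->
  `|log_ratio (model phi x l) (model phi x' l) y| <= score_bound phi E W.
Proof.
move=> hC xT x'T; apply: log_ratio_sigmoid_bound; apply: score_bound_ge => //;
  exact: triples_edge_param.
Qed.

Lemma sum_KL_loss x x' : (0 < #|{: edge N K}|)%N ->
  \sum_l KL (model phi x l) (model phi x' l) =
  #|{: edge N K}|%:R * loss (model phi x') (model phi x).
Proof. by move=> c0; rewrite /loss mulrA mulfV ?mul1r// pnatr_eq0 -lt0n. Qed.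

Section lipschitz.
Variables (E : set 'rV[R]_dE) (W : set 'rV[R]_dR) (alpha : R).
Hypothesis hphi : forall u v, triples E W u -> triples E W v ->
  `|phi u - phi v| <= alpha * enorm (u - v).

Lemma log_ratio_model_lipschitz x x' l y delta : 0 <= alpha ->
  Theta E W x -> Theta E W x' ->
  (forall i, enorm (x.1 i - x'.1 i) <= delta) ->
  (forall k, enorm (x.2 k - x'.2 k) <= delta) ->
  log_ratio (model phi x l) (model phi x' l) y <= alpha * (Num.sqrt 3 * delta).
Proof.
move=> a0 xT x'T d1 d2; apply: (le_trans (log_ratio_sigmoid_lipschitz _ _ _)).
apply: (le_trans (hphi (triples_edge_param l xT) (triples_edge_param l x'T))).
by rewrite ler_wpM2l// tripleB enorm_triple_le.
Qed.

(** With [alpha <= 0] the score is constant on triples, so all parameters give the same model. *)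
Lemma loss_eq0_of_nonpos_lipschitz x x' : alpha <= 0 ->
  Theta E W x -> Theta E W x' -> loss (model phi x) (model phi x') = 0.
Proof.
move=> a0 xT x'T; rewrite /loss big1 ?mulr0// => l _.
have -> : model phi x' l = model phi x l.
  rewrite /model; congr sigmoid; apply/eqP; rewrite -subr_eq0 -normr_le0.
  apply: (le_trans (hphi (triples_edge_param l x'T) (triples_edge_param l xT))).
  by rewrite mulr_le0_ge0// enorm_ge0.
have /andP[p0 p1] := model01 x l.
by rewrite /KL !divff ?ln1 ?mulr0 ?addr0// gt_eqF// subr_gt0.
Qed.

(** Two distinct triples exclude a negative constant: the centers, and the centers with one
    coordinate shifted by [U]. *)
Lemma lipschitz_const_ge0 (cE : 'rV[R]_dE) (cR : 'rV[R]_dR) U :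
  E = eball cE U -> W = eball cR U -> 0 < U -> (0 < dE + dR)%N -> 0 <= alpha.
Proof.
move=> hE hW U0 dd.
have center n (c : 'rV[R]_n) : eball c U c.
  by rewrite /eball /= subrr -(scale0r 0) enormZ normr0 mul0r ltW.
have pole n (c : 'rV[R]_n) i : eball c U (c + U *: delta_mx 0 i).
  rewrite /eball /= addrAC subrr add0r enormZ gtr0_norm// ger_pMr//.
  rewrite /enorm (bigD1 i)//= big1 ?addr0 ?mxE ?eqxx ?expr1n ?sqrtr1//.
  by move=> j /negPf ji; rewrite mxE ji andbF expr0n.
suff [u [v [j [Eu Ev uv]]]] : exists u v j,
    [/\ triples E W u, triples E W v & (u - v) 0 j = U].
  have e0 : 0 < enorm (u - v).
    by rewrite (lt_le_trans _ (enorm_coord_le _ j))// uv normr_gt0 gt_eqF.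
  by rewrite -(pmulr_lge0 _ e0) (le_trans _ (hphi Eu Ev)).
case: (posnP dE) => [dE0|dE0].
  have j : 'I_dR by apply: Ordinal (_ : (0 < dR)%N); move: dd; rewrite dE0.
  exists (triple cE cE (cR + U *: delta_mx 0 j)), (triple cE cE cR), (rshift _ j).
  rewrite tripleB /triple row_mxEr addrAC subrr add0r !mxE !eqxx mulr1 hE hW.
  by split=> //; [exists cE, cE, (cR + U *: delta_mx 0 j)|exists cE, cE, cR]; split.
have j : 'I_dE := Ordinal dE0.
exists (triple (cE + U *: delta_mx 0 j) cE cR), (triple cE cE cR), (lshift _ (lshift _ j)).
rewrite tripleB /triple !row_mxEl addrAC subrr add0r !mxE !eqxx mulr1 hE hW.
by split=> //; [exists (cE + U *: delta_mx 0 j), cE, cR|exists cE, cE, cR]; split.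
Qed.

End lipschitz.
End network_model.

(** * Combination of the net, the union bound and the two deviation bounds *)

Unset Implicit Arguments.

Theorem lemma1 (R : realType) (N K dE dR : nat)
    (* parameter sets: closed Euclidean balls of radius U *)
    (U : R) (cE : 'rV[R]_dE) (cR : 'rV[R]_dR)
    (E : set 'rV[R]_dE) (W : set 'rV[R]_dR)
    (hU : 0 <= U) (hE : E = eball cE U) (hW : W = eball cR U)
    (* score function *)
    (phi : 'rV[R]_(dE + dE + dR) -> R) (alpha : R)
    (hphi : forall u v, triples E W u -> triples E W v ->
       `|phi u - phi v| <= alpha * enorm (u - v))
    (hC : 2 <= score_bound phi E W)
    (* true parameter and data *)
    (xstar : param R N K dE dR) (hxstar : Theta E W xstar)
    (gamma : R) (hgamma : 0 < gamma <= 1)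
    (d : measure_display) (T : measurableType d) (P : probability T R)
    (Y Obs : edge N K -> {RV P >-> bool})
    (hY : forall l, distribution P (Y l) =1 bernoulli_prob (model phi xstar l))
    (hO : forall l, distribution P (Obs l) =1 bernoulli_prob gamma)
    (hind : mutually_independent (edge_data Y Obs))
    (* maximum likelihood estimator *)
    (xhat : T -> param R N K dE dR)
    (hxhat : forall w,
       is_mle phi E W (fun l => Y l w) (observed Obs w) (xhat w))
    (t beta s : R) :
  let C := score_bound phi E W in
  let n := gamma * (N ^ 2 * K)%:R in
  let m := (N * dE + K * dR)%N in
  let bad := [set w | t <= loss (model phi (xhat w)) (model phi xstar)] in
  0 < t -> 0 < beta -> 0 < s < n * t ->
  measurable bad ->
  (P bad <=
    (expR (- ((n * t - s) / C * hfun (2^-1 - s / (2 * n * t))))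
       * (1 + 2 * Num.sqrt 3 * alpha * U * n * (1 + beta) / s) ^+ m
     + expR (- (n * beta * hfun beta)))%:E)%E.
Proof.
move=> C n m bad t0 b0 /[dup] /andP[s0 snt] s01 mbad.
have n0 : 0 < n.
  by rewrite -(pmulr_lgt0 _ t0); lra.
have beta1 : 0 < 1 + beta by lra.
have [g0 g1] := andP hgamma.
have nE : n = gamma * #|{: edge N K}|%:R.
  by rewrite /n !card_prod !card_ord expnS expn1.
clearbody n.
have card0 : (0 < #|{: edge N K}|)%N.
  by rewrite lt0n; apply/negP => /eqP c0; move: n0; rewrite nE c0 mulr0 ltxx.
have xhatT w : Theta E W (xhat w) by have [] := hxhat w.
pose base := 1 + 2 * Num.sqrt 3 * alpha * U * n * (1 + beta) / s.
have baseE : base = 1 + 2 * Num.sqrt 3 * (alpha * U) * n * (1 + beta) / s.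
  by rewrite /base !mulrA.
(* A negative [alpha] is possible only if all triples coincide. *)
have [a_le0|a0] := leP alpha 0.
  have -> : bad = set0.
    rewrite -subset0 => w; rewrite /bad /= (loss_eq0_of_nonpos_lipschitz hphi)//; lra.
  rewrite measure0 lee_fin addr_ge0 ?expR_ge0// mulr_ge0 ?expR_ge0// -/base.
  have [aU|aU] := leP 0 (alpha * U).
    rewrite exprn_ge0// baseE; move: (alpha * U) aU => a a0.
    by rewrite addr_ge0// divr_ge0 ?(ltW s0)// !mulr_ge0 ?sqrtr_ge0 ?(ltW n0) ?(ltW beta1).
  (* Here [alpha < 0 < U], and [base] may be negative. A positive [m] would give two distinct
     triples, hence [0 <= alpha]; so the power is 1. *)
  have -> : m = 0%N; last by rewrite expr0.
  apply/eqP; rewrite -leqn0 leqNgt; apply/negP => m0.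
  have U0 : 0 < U by rewrite lt_def hU andbT; apply: contraTneq aU => ->; rewrite mulr0 ltxx.
  have dd : (0 < dE + dR)%N.
    by move: m0; rewrite /m !addn_gt0 !muln_gt0 => /orP[] /andP[_ ->] //;
      rewrite orbT.
  have := lipschitz_const_ge0 hphi hE hW U0 dd; nra.
have sqrt3 : 0 < Num.sqrt 3 :> R by rewrite sqrtr_gt0.
pose delta := s / (Num.sqrt 3 * alpha * n * (1 + beta)).
have d0 : 0 < delta by rewrite divr_gt0// !mulr_gt0.
pose A := [set x | Theta E W x /\ t <= loss (model phi x) (model phi xstar)].
have AT : A `<=` Theta (eball cE U) (eball cR U) by rewrite -hE -hW => x [].
have [M [x [Mle xA xnet]]] := param_net hU d0 AT.
have {}Mle : M%:R <= base ^+ m.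
  apply: (le_trans Mle); rewrite le_eqVlt; apply/orP; left; apply/eqP; congr (_ ^+ _).
  by rewrite /base /delta; field; rewrite !gt_eqF.
pose p l := model phi xstar l.
have p01 l : 0 < p l < 1 := model01 _ _ l.
have p01' l : 0 <= p l <= 1 by have /andP[h1 h2] := p01 l; rewrite !ltW.
have gamma01 : 0 <= gamma <= 1 by rewrite ltW.
pose excess j (f : {ffun edge N K -> bool * bool}) :=
  \sum_l (if (f l).2 then log_ratio (p l) (model phi (x j) l) (f l).1 else 0).
pose seen (f : {ffun edge N K -> bool * bool}) : R := \sum_l (f l).2%:R.
pose Qs j : pred {ffun edge N K -> bool * bool} := fun f => excess j f <= s.
pose Q' : pred {ffun edge N K -> bool * bool} := fun f => n * (1 + beta) <= seen f.
pose Q : pred {ffun edge N K -> bool * bool} := fun f => Q' f || [exists j, Qs j f].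
have badQ w : bad w -> Q (config Y Obs w).
  rewrite /bad /= => tw; rewrite /Q /Q'.
  case: (leP (n * (1 + beta)) (seen (config Y Obs w))) => //= few.
  have [j [d1 d2]] := xnet (xhat w) (conj (xhatT w) tw).
  apply/existsP; exists j; rewrite /Qs.
  have xjT : Theta E W (x j) by have [] := xA j.
  have -> : excess j (config Y Obs w) =
      loglik phi xstar (Y^~ w) (observed Obs w) - loglik phi (x j) (Y^~ w) (observed Obs w).
    rewrite loglikB /excess [RHS]big_mkcond; apply: eq_bigr => l _.
    by rewrite ffunE /= inE.
  (* Maximality lets [xhat w] replace [xstar]; what remains compares [xhat w] with a nearby net
     point, edge by edge. *)
  have [_ /(_ _ hxstar) mle] := hxhat w.
  suff : loglik phi (xhat w) (Y^~ w) (observed Obs w)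
      - loglik phi (x j) (Y^~ w) (observed Obs w) <= s by lra.
  rewrite loglikB.
  apply: (@le_trans _ _ (\sum_(l in observed Obs w) alpha * (Num.sqrt 3 * delta))).
    by apply: ler_sum => l _; apply: (log_ratio_model_lipschitz hphi); rewrite ?ltW.
  have -> : \sum_(l in observed Obs w) alpha * (Num.sqrt 3 * delta) =
      alpha * (Num.sqrt 3 * delta) * seen (config Y Obs w).
    rewrite big_mkcond mulr_sumr; apply: eq_bigr => l _.
    by rewrite ffunE /= inE; case: (Obs l w); rewrite ?mulr1 ?mulr0.
  have -> : s = alpha * (Num.sqrt 3 * delta) * (n * (1 + beta)).
    by rewrite /delta; field; rewrite !gt_eqF.
  by rewrite ler_wpM2l// ltW// mulr_gt0// mulr_gt0.
apply: (le_trans (prob_le_config p01' gamma01 hY hO hind mbad badQ)).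
rewrite lee_fin.
have w_ge0 l b : 0 <= bernoulli_pmf (p l) b.1 * bernoulli_pmf gamma b.2.
  by rewrite mulr_ge0// bernoulli_pmf_ge0.
apply: (le_trans (finite_union_bound w_ge0 (Q' := Q') (Qs := Qs) _)).
  by move=> f /orP[]; [left|move=> /existsP; right].
apply: lerD; last exact: observation_deviation.
rewrite mulrC; apply: (@le_trans _ _ (M%:R *
  expR (- ((n * t - s) / C * hfun (2^-1 - s / (2 * n * t)))))); last first.
  by rewrite ler_wpM2r ?expR_ge0.
rewrite -[M in M%:R](card_ord M) mulr_natl -sumr_const; apply: ler_sum => j _.
(* A net point is itself bad, so [gamma] times its total divergence is at least [n * t], the value
   taken for [a]. *)
have [xjT tj] := xA j.
apply: likelihood_deviation => //.
- by move=> l; exact: model01.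
- by move=> l y; apply: (log_ratio_model_bound l y hC).
- by rewrite sum_KL_loss// mulrA -nE ler_wpM2l// ltW.
- by rewrite mulrA.
Qed.
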